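(* Let $D=\{(x,y)\in\mathbb C^2:\operatorname{Im}(x\bar y)>0\}$ and let $\tilde\omega$ be the Kähler form on $D$ with global Kähler potential $\Phi=\operatorname{Im}(x\bar y)^{-1}$. Then the Kähler manifold $(D,\tilde\omega)$ admits a Kähler immersion into $\ell^2(\mathbb C)$.
   Context: A Kähler potential $\Phi$ for $\tilde\omega$ means $\tilde\omega=\frac{\sqrt{-1}}2\partial\bar\partial\Phi$. A Kähler immersion of $(D,\tilde\omega)$ into $\ell^2(\mathbb C)$ is a holomorphic map $f\colon D\to\ell^2(\mathbb C)$ with $f^*\omega_0=\tilde\omega$, where $\omega_0=\frac{\sqrt{-1}}2\partial\bar\partial\|z\|^2$ is the flat Kähler form. *)

(* Defs.v *)
From HB Require Import structures.
From mathcomp Require Import all_boot all_order all_algebra.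
From mathcomp Require Import all_classical all_reals all_analysis.
From mathcomp Require Import complex ring lra.

Set Implicit Arguments.
Unset Strict Implicit.
Unset Printing Implicit Defensive.

Import Order.TTheory GRing.Theory Num.Theory.
Import numFieldNormedType.Exports.

Local Open Scope classical_set_scope.
Local Open Scope ring_scope.
Local Open Scope complex_scope.

Notation normc := ComplexField.Normc.normc.

Section SquareSummable.
Variable R : realType.
Implicit Types a b z : nat -> R[i].

Definition sqnorm z : nat -> R := fun n => normc (z n) ^+ 2.

Definition square_summable z : Prop := cvgn (series (sqnorm z)).

Definition l2norm z : R := Num.sqrt (limn (series (sqnorm z))).

Lemma sqnorm_ge0 z n : 0 <= sqnorm z n.
Proof. exact: sqr_ge0. Qed.

Lemma normc_ge0 (x : R[i]) : 0 <= normc x.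
Proof. by case: x => x y; rewrite sqrtr_ge0. Qed.

Lemma sqnormD a b (s : R) n : 0 < s ->
  sqnorm (a + b) n <= (1 + s) * sqnorm a n + (1 + s^-1) * sqnorm b n.
Proof.
move=> s0; rewrite /sqnorm.
have h : normc (a n + b n) ^+ 2 <= (normc (a n) + normc (b n)) ^+ 2.
  by rewrite ler_sqr ?nnegrE ?addr_ge0 ?normc_ge0// le_normcD.
apply: (le_trans h); set x := normc _; set y := normc _.
rewrite -subr_ge0.
have -> : (1 + s) * x ^+ 2 + (1 + s^-1) * y ^+ 2 - (x + y) ^+ 2
          = s^-1 * (s * x - y) ^+ 2 by field; rewrite gt_eqF.
by rewrite mulr_ge0 ?sqr_ge0// invr_ge0 ltW.
Qed.

Lemma sqnormZ (k : R[i]) z : sqnorm (k *: z) = normc k ^+ 2 *: sqnorm z.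
Proof. by apply/funext => n; rewrite /sqnorm/= ComplexField.Normc.normcM exprMn. Qed.

Lemma square_summable0 : square_summable 0.
Proof.
rewrite /square_summable (_ : series _ = cst 0); first exact: is_cvg_cst.
apply/funext => n; rewrite /series/= big1// => i _.
by rewrite /sqnorm ComplexField.Normc.normc0 expr0n.
Qed.

Lemma square_summableZ k z : square_summable z -> square_summable (k *: z).
Proof. by move=> h; rewrite /square_summable sqnormZ; exact: is_cvg_seriesZ. Qed.

Lemma square_summableD a b :
  square_summable a -> square_summable b -> square_summable (a + b).
Proof.
move=> ha hb; apply: (@series_le_cvg _ _
  ((1 + 1) *: sqnorm a + (1 + 1^-1) *: sqnorm b)).
- exact: sqnorm_ge0.
- move=> n; rewrite addr_ge0//.
    by apply: mulr_ge0; rewrite ?sqnorm_ge0 ?addr_ge0 ?invr_ge0.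
  by apply: mulr_ge0; rewrite ?sqnorm_ge0 ?addr_ge0 ?invr_ge0.
- by move=> n; exact: sqnormD.
- by apply: is_cvg_seriesD; exact: is_cvg_seriesZ.
Qed.

Definition square_summable_pred : {pred nat -> R[i]} :=
  fun z => `[< square_summable z >].

Lemma square_summable_submod_closed : submod_closed square_summable_pred.
Proof.
split; first exact/asboolP/square_summable0.
move=> k a b /asboolP ha /asboolP hb; apply/asboolP.
by apply: square_summableD => //; exact: square_summableZ.
Qed.

HB.instance Definition _ := GRing.isSubmodClosed.Build R[i] (nat -> R[i])
  square_summable_pred square_summable_submod_closed.

Lemma lim_series_sqnorm_ge0 z :
  square_summable z -> 0 <= limn (series (sqnorm z)).
Proof.
move=> hz; apply: limr_ge => //; apply: nearW => n.
by apply: sumr_ge0 => i _; exact: sqnorm_ge0.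
Qed.

Lemma sqnorm_le_lim z n :
  square_summable z -> sqnorm z n <= limn (series (sqnorm z)).
Proof.
move=> hz; apply: (@le_trans _ _ (series (sqnorm z) n.+1)).
  rewrite seriesSr lerDr; apply: sumr_ge0 => i _; exact: sqnorm_ge0.
apply: nondecreasing_cvgn_le => //.
by apply: nondecreasing_series => i _ _; exact: sqnorm_ge0.
Qed.

Lemma l2norm_eq0 z : square_summable z -> l2norm z = 0 -> z = 0.
Proof.
move=> hz /eqP; rewrite sqrtr_eq0 => h; apply/funext => n.
have := le_trans (sqnorm_le_lim n hz) h.
rewrite /sqnorm => hn.
apply: ComplexField.Normc.eq0_normc; apply/eqP.
by rewrite -sqrf_eq0 eq_le hn sqr_ge0.
Qed.

Lemma l2normZ k z : square_summable z -> l2norm (k *: z) = normc k * l2norm z.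
Proof.
move=> hz; rewrite /l2norm sqnormZ lim_seriesZ//= sqrtrM ?sqr_ge0//.
by rewrite sqrtr_sqr ger0_norm ?normc_ge0.
Qed.

Lemma l2normD a b : square_summable a -> square_summable b ->
  l2norm (a + b) <= l2norm a + l2norm b.
Proof.
move=> ha hb.
have [a0|a0] := eqVneq (l2norm a) 0.
  by rewrite (l2norm_eq0 ha a0) add0r lerDr sqrtr_ge0.
have [b0|b0] := eqVneq (l2norm b) 0.
  by rewrite (l2norm_eq0 hb b0) addr0 lerDl sqrtr_ge0.
have pa : 0 < l2norm a by rewrite lt_neqAle eq_sym a0 sqrtr_ge0.
have pb : 0 < l2norm b by rewrite lt_neqAle eq_sym b0 sqrtr_ge0.
have hab := square_summableD ha hb.
have s0 : 0 < l2norm b / l2norm a by rewrite divr_gt0.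
have key : l2norm (a + b) ^+ 2 <= (1 + l2norm b / l2norm a) * l2norm a ^+ 2
    + (1 + (l2norm b / l2norm a)^-1) * l2norm b ^+ 2.
  rewrite /l2norm !sqr_sqrtr ?lim_series_sqnorm_ge0// -!/(l2norm _).
  set s := _ / _.
  have -> : (1 + s) * limn (series (sqnorm a))
      + (1 + s^-1) * limn (series (sqnorm b))
      = limn (series ((1 + s) *: sqnorm a + (1 + s^-1) *: sqnorm b)).
    rewrite lim_seriesD; [|exact: is_cvg_seriesZ|exact: is_cvg_seriesZ].
    by rewrite !lim_seriesZ.
  apply: lim_series_le => //.
    by apply: is_cvg_seriesD; exact: is_cvg_seriesZ.
  by move=> n; exact: sqnormD.
rewrite -ler_sqr ?nnegrE ?addr_ge0 ?sqrtr_ge0//.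
apply: (le_trans key); rewrite le_eqVlt; apply/orP; left; apply/eqP.
by field; rewrite a0 b0.
Qed.

End SquareSummable.

Record ell2 (R : realType) := Ell2 {
  ell2_seq :> nat -> R[i];
  ell2_seqP : ell2_seq \in @square_summable_pred R }.

HB.instance Definition _ (R : realType) := [isSub for @ell2_seq R].
HB.instance Definition _ (R : realType) := [Choice of ell2 R by <:].
HB.instance Definition _ (R : realType) :=
  [SubChoice_isSubLmodule of ell2 R by <:].

Section Ell2Norm.
Variable R : realType.
Implicit Types x y : ell2 R.

(* A normed module over R[i] has its norm valued in R[i]. *)
Let ell2_norm x : R[i] := (l2norm x)%:C.

Let ell2_square_summable x : square_summable x.
Proof. by case: x => x /= /asboolP. Qed.

Let ell2_normD x y : ell2_norm (x + y) <= ell2_norm x + ell2_norm y.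
Proof. by rewrite /ell2_norm -rmorphD/= lecR; exact: l2normD. Qed.

Let ell2_normZ (k : R[i]) x : ell2_norm (k *: x) = `|k| * ell2_norm x.
Proof.
rewrite /ell2_norm (_ : `|k| = (normc k)%:C)// -rmorphM/=; congr (_%:C).
exact: l2normZ.
Qed.

Let ell2_norm_eq0 x : ell2_norm x = 0 -> x = 0.
Proof.
by move=> /complexI h; apply/val_inj; exact: (l2norm_eq0 _ h).
Qed.

HB.instance Definition _ := Lmodule_isNormed.Build R[i] (ell2 R)
  ell2_normD ell2_normZ ell2_norm_eq0.

End Ell2Norm.

(* A complex-valued 2-form on [V] is a function [omega p u v] of a base point
   [p] and two tangent vectors [u v]; the complex structure of the tangent
   space [V] is multiplication by ['i]. *)

Section Forms.
Variables (R : realType) (V : normedModType R[i]).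
Implicit Types (D : set V) (g : V -> R[i]) (phi : V -> R) (p u v w : V)
  (omega : V -> V -> V -> R[i]).

Definition along g p v : R -> R[i] := fun t => g (p + t%:C *: v).

(* The derivative of [g] at [p] in the real direction [v]: [R[i]] carries no
   real normed module structure, so the two components are differentiated. *)
Definition rderive g v p : R[i] :=
  derive1 (fun t => complex.Re (along g p v t)) 0 +i*
  derive1 (fun t => complex.Im (along g p v t)) 0.

Definition rderivable g v p : Prop :=
  derivable (fun t => complex.Re (along g p v t)) 0 1 /\
  derivable (fun t => complex.Im (along g p v t)) 0 1.

(* All iterated directional derivatives up to order [n] exist and are
   continuous on [D]. *)
Fixpoint Cn (n : nat) D g : Prop :=
  {in D, continuous (g : V -> R[i]^o)} /\
  if n is m.+1 then
    forall v, (forall p, D p -> rderivable g v p) /\ Cn m D (rderive g v)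
  else True.

Definition smooth_on D g : Prop := forall n, Cn n D g.

(* Contractions with [v] of [d'g] and [d''g]: for [v] the j-th vector of a
   complex basis these are the Wirtinger derivatives of [g] with respect to
   [z_j] and [conj z_j]. *)
Definition del g v p : R[i] :=
  2^-1 * (rderive g v p - 'i * rderive g ('i *: v) p).

Definition delbar g v p : R[i] :=
  2^-1 * (rderive g v p + 'i * rderive g ('i *: v) p).

(* The (1,1)-form [d'(d''g)], with [(alpha /\ beta)(u, v) =
   alpha(u) beta(v) - alpha(v) beta(u)]. *)
Definition del_delbar g p u v : R[i] :=
  del (delbar g v) u p - del (delbar g u) v p.

Definition kahler_of_potential phi p u v : R[i] :=
  'i / 2 * del_delbar (fun q => (phi q)%:C) p u v.

Definition is_2form D omega : Prop :=
  forall p, D p ->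
    (forall u v, omega p u v = - omega p v u) /\
    (forall (t : R) u v w,
       omega p u (t%:C *: v + w) = t%:C * omega p u v + omega p u w).

Definition is_real_11form D omega : Prop :=
  forall p, D p -> forall u v,
    omega p u v \is Num.real /\ omega p ('i *: u) ('i *: v) = omega p u v.

(* [d omega] evaluated on constant vector fields. *)
Definition closed_2form D omega : Prop :=
  forall p, D p -> forall u v w,
    rderive (fun q => omega q v w) u p - rderive (fun q => omega q u w) v p
    + rderive (fun q => omega q u v) w p = 0.

(* Positivity of the metric [g(u, v) = omega(u, J v)]; in [R[i]], [0 < z]
   means that [z] is real and positive. *)
Definition positive_2form D omega : Prop :=
  forall p, D p -> forall v, v != 0 -> 0 < omega p v ('i *: v).

Definition kahler_form D omega : Prop :=
  [/\ is_2form D omega,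
      (forall u v, smooth_on D (fun p => omega p u v)),
      is_real_11form D omega,
      closed_2form D omega &
      positive_2form D omega].

Definition kahler_domain D omega : Prop := open D /\ kahler_form D omega.

End Forms.

Section KahlerImmersion.
Variables (R : realType) (V : normedModType R[i]).

Definition omega0 (z u v : ell2 R) : R[i] :=
  kahler_of_potential (fun x : ell2 R => l2norm x ^+ 2) z u v.

(* Complex Frechet differentiability at every point of [D]. *)
Definition holomorphic_on (D : set V) (f : V -> ell2 R) : Prop :=
  forall p, D p -> differentiable f p.

(* The tangent map at [p] is ['d f p], so [f^* omega0] is evaluated by applying
   [omega0] at [f p] to the images of the tangent vectors. *)
Definition kahler_immersion (D : set V) (omega : V -> V -> V -> R[i])
    (f : V -> ell2 R) : Prop :=
  holomorphic_on D f /\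
  forall p, D p -> forall u v,
    omega0 (f p) ('d f p u) ('d f p v) = omega p u v.

End KahlerImmersion.

Section Example.
Variable R : realType.

Definition C2 := (R[i]^o * R[i]^o)%type.

Definition imxy (p : C2) : R := complex.Im ((p.1 : R[i]) * (p.2 : R[i])^*).

Definition domD : set C2 := [set p | 0 < imxy p].

Definition Phi (p : C2) : R := (imxy p)^-1.

Definition omega_tilde : C2 -> C2 -> C2 -> R[i] := kahler_of_potential Phi.

End Example.

Arguments domD : clear implicits.
Arguments omega_tilde : clear implicits.

(* Main.v *)
(* With [a = x + i y] and [b = x - i y] one has [4 Im(x ybar) = |a|^2 - |b|^2],
   so that [Phi = (4 / |a|^2) / (1 - |b / a|^2) = sum_k |2 b^k / a^(k+1)|^2].
   Hence [f = (2 / a) (1, w, w^2, ...)] with [w = b / a] is a holomorphic map of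
   [D] into l^2 with [|f|^2 = Phi].  Its differential lives in the span of
   [(w^k)_k] and [(k w^(k-1))_k], whose Gram matrix is given by three power
   series in [|w|^2], and [<df u, df v>] is the Levi form of [Phi]. *)

Require Import Defs.
From HB Require Import structures.
From mathcomp Require Import all_boot all_order all_algebra.
From mathcomp Require Import all_classical all_reals all_analysis.
From mathcomp Require Import complex ring lra.

Set Implicit Arguments.
Unset Strict Implicit.
Unset Printing Implicit Defensive.

Import Order.TTheory GRing.Theory Num.Theory.
Import numFieldNormedType.Exports.

Local Open Scope classical_set_scope.
Local Open Scope ring_scope.
Local Open Scope complex_scope.

(** * Real directional derivatives *)

(** The functions [a] and [b] diagonalize the Hermitian form of signature (1,1) behind [Im(x ybar)];
    this is why [|b / a| < 1] on [D]. The equality [|f|^2 = Phi] is not itself differentiated, which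
    would need a chain rule for real directional derivatives through l^2. Instead each of the two
    forms is shown to be minus the imaginary part of an explicit Hermitian form: the Levi form of
    [Phi] on [D], and the inner product on l^2. The immersion property then becomes an identity
    between rational functions of the coordinates and their conjugates. The analytic obstacle is
    that holomorphy into l^2 is not a componentwise matter: the Taylor remainder has to be small in
    norm. Hence the bound [n^2 r^(n-1) <= C s^n], which makes the componentwise remainders geometric
    in [n], with one ratio for all small increments. *)

Section RealDerivative.
Variables (R : realType) (V : normedModType R[i]).
Implicit Types (g h : V -> R[i]) (p v : V) (d e c : R[i]) (D : set V).

(** [rderive] is total and has a value even where no derivative exists; this relation carries
    existence along with the value, so that both propagate through sums, products and inverses. *)
Definition has_rderive g v p d : Prop :=
  is_derive (0 : R) 1 (fun t => complex.Re (along g p v t)) (complex.Re d) /\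
  is_derive (0 : R) 1 (fun t => complex.Im (along g p v t)) (complex.Im d).

Lemma has_rderive_rderivable g v p d : has_rderive g v p d -> rderivable g v p.
Proof. by case=> -[hr _] [hi _]; exact: conj hr hi. Qed.

Lemma has_rderiveE g v p d : has_rderive g v p d -> rderive g v p = d.
Proof.
by case: d => a b [[_ ha] [_ hb]]; rewrite /rderive !derive1E ha hb.
Qed.

Lemma rderivableP g v p : rderivable g v p -> has_rderive g v p (rderive g v p).
Proof. by case=> hr hi; split; rewrite /rderive /= derive1E; exact: derivableP. Qed.

Lemma normC_real (x : R) : `|x%:C| = `|x|%:C :> R[i].
Proof. by rewrite normc_def /= expr0n addr0 sqrtr_sqr. Qed.

Lemma real_complex_continuous : continuous (fun t : R => (t%:C : R[i]^o)).
Proof.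
move=> t; apply/cvgrPdist_lt => e; rewrite ltcE /= => /andP[/eqP e0 e1].
have : \forall s \near t, `|t - s| < complex.Re e.
  by apply: (@cvgr_dist_lt _ R^o _ (nbhs t) _ id t) => //; exact: cvg_id.
apply: filterS => s hs.
by rewrite -rmorphB /= normC_real ltcE /= e0 eqxx.
Qed.

Lemma line_continuous p v : continuous (fun t : R => p + t%:C *: v).
Proof.
move=> t; apply: cvgD; first exact: cvg_cst.
apply: cvgZr_tmp; exact: real_complex_continuous.
Qed.

(** For small [t] the line through [p] stays in the open set [D], so the derivative sees only values
    on [D]. Second derivatives of [Phi] depend on this: its first derivatives have a closed formula
    on [D] only. *)
Lemma has_rderive_ext D g h v p d : open D -> D p -> {in D, g =1 h} ->
  has_rderive h v p d -> has_rderive g v p d.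
Proof.
move=> oD Dp gh hd.
have nD : \forall t \near (0 : R), D (p + t%:C *: v).
  apply: (@line_continuous p v 0); rewrite rmorph0 scale0r addr0.
  exact: open_nbhs_nbhs.
by case: hd => hr hi; split; [move: hr | move: hi]; apply: near_eq_is_derive;
  apply: filterS nD => t Dt; rewrite /along gh// inE.
Qed.

Lemma continuous_ext D g h : open D -> {in D, g =1 h} ->
  {in D, continuous (h : V -> R[i]^o)} -> {in D, continuous (g : V -> R[i]^o)}.
Proof.
move=> oD gh hc p pD; have Dp : D p by rewrite inE in pD.
rewrite /continuous_at gh//; apply: cvg_trans (hc _ pD).
apply: near_eq_cvg; apply: filterS (open_nbhs_nbhs (conj oD Dp)) => q Dq.
by rewrite gh// inE.
Qed.

Lemma Cn_ext n D g h : open D -> {in D, g =1 h} -> Cn n D h -> Cn n D g.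
Proof.
move=> oD; elim: n g h => [|n IHn] g h gh [hc hd].
  by split; first exact: continuous_ext oD gh hc.
split; first exact: continuous_ext oD gh hc.
move=> v; have [hv hCn] := hd v.
have gv p : D p -> has_rderive g v p (rderive h v p).
  by move=> Dp; apply: (has_rderive_ext oD Dp gh); exact: rderivableP (hv _ Dp).
split; first by move=> p /gv /has_rderive_rderivable.
by apply: (IHn _ (rderive h v)) hCn => p; rewrite inE => /gv /has_rderiveE.
Qed.

(** A real differential splits into a complex linear part [d] and an antilinear part [e], which ['i]
    multiplies by ['i] and [- 'i] respectively; [del] and [delbar] extract them. *)
Lemma del_delbarE g v p d e : rderive g v p = d + e ->
  rderive g ('i *: v) p = 'i * (d - e) -> del g v p = d /\ delbar g v p = e.
Proof.
rewrite /del /delbar => -> ->; rewrite mulrA -expr2 sqr_i mulN1r.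
by split; field.
Qed.

(* Covers real-affine functions, for which [e = 0]. *)
Lemma has_rderive_quadratic g v p d e :
  (forall t : R, g (p + t%:C *: v) = g p + t%:C * d + t%:C ^+ 2 * e) ->
  has_rderive g v p d.
Proof.
move=> gE; case: d gE => d1 d2 gE.
have quad (a b c : R) : is_derive (0 : R) 1 (fun t : R => a + t * b + t ^+ 2 * c) b.
  by apply: is_derive_eq; rewrite /GRing.scale /= !mulr0 !mul0r; ring.
split => /=.
  rewrite (_ : (fun _ => _) =
    (fun t : R => complex.Re (g p) + t * d1 + t ^+ 2 * complex.Re e)).
    exact: quad.
  apply/funext => t; rewrite /along gE.
  by case: (g p) => ? ?; case: e {gE} => ? ?; rewrite expr2 /=; ring.
rewrite (_ : (fun _ => _) =
    (fun t : R => complex.Im (g p) + t * d2 + t ^+ 2 * complex.Im e)).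
  exact: quad.
apply/funext => t; rewrite /along gE.
by case: (g p) => ? ?; case: e {gE} => ? ?; rewrite expr2 /=; ring.
Qed.

Lemma has_rderiveD g h v p d e : has_rderive g v p d -> has_rderive h v p e ->
  has_rderive (fun q => g q + h q) v p (d + e).
Proof.
move=> [gr gi] [hr hi]; split.
  rewrite (_ : (fun _ => _) =
    (fun t => complex.Re (along g p v t)) + (fun t => complex.Re (along h p v t))).
    by apply: is_derive_eq; case: d {gr gi} => ? ?; case: e {hr hi}.
  by apply/funext => t; rewrite /along !fctE; case: (g _) => ? ?; case: (h _).
rewrite (_ : (fun _ => _) =
    (fun t => complex.Im (along g p v t)) + (fun t => complex.Im (along h p v t))).
  by apply: is_derive_eq; case: d {gr gi} => ? ?; case: e {hr hi}.
by apply/funext => t; rewrite /along !fctE; case: (g _) => ? ?; case: (h _).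
Qed.

Lemma has_rderiveM g h v p d e : has_rderive g v p d -> has_rderive h v p e ->
  has_rderive (fun q => g q * h q) v p (d * h p + g p * e).
Proof.
move=> [gr gi] [hr hi]; split.
  rewrite (_ : (fun _ => _) =
    (fun t => complex.Re (along g p v t)) * (fun t => complex.Re (along h p v t))
    - (fun t => complex.Im (along g p v t)) * (fun t => complex.Im (along h p v t))).
    apply: is_derive_eq; rewrite /along rmorph0 scale0r addr0 /GRing.scale /=.
    by case: d {gr gi} => ? ?; case: e {hr hi} => ? ?; case: (g p) => ? ?;
      case: (h p) => ? ? /=; ring.
  by apply/funext => t; rewrite /along !fctE; case: (g _) => ? ?; case: (h _).
rewrite (_ : (fun _ => _) =
    (fun t => complex.Re (along g p v t)) * (fun t => complex.Im (along h p v t))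
    + (fun t => complex.Im (along g p v t)) * (fun t => complex.Re (along h p v t))).
  apply: is_derive_eq; rewrite /along rmorph0 scale0r addr0 /GRing.scale /=.
  by case: d {gr gi} => ? ?; case: e {hr hi} => ? ?; case: (g p) => ? ?;
    case: (h p) => ? ? /=; ring.
by apply/funext => t; rewrite /along !fctE; case: (g _) => ? ?; case: (h _).
Qed.

Lemma has_rderive_inv_real (phi : V -> R) v p d : phi p != 0 ->
  has_rderive (fun q => (phi q)%:C) v p d ->
  has_rderive (fun q => (phi q)^-1%:C) v p (- ((phi p)^-1%:C) ^+ 2 * d).
Proof.
move=> p0 [dr di]; case: d dr di => d1 d2 /= dr di.
(* The function is real-valued, so its imaginary part is constantly 0 along the line. *)
have d20 : d2 = 0.
  case: di => _ <-; exact: derive_cst.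
rewrite d20 expr2; split => /=; last first.
  apply: (is_derive_eq (is_derive_cst _ _ _)).
  by rewrite !(mulr0, mul0r, addr0, subr0, oppr0).
rewrite /along /= in dr *.
have p0' : phi (p + (0 : R)%:C *: v) != 0 by rewrite rmorph0 scale0r addr0.
split; first by apply: derivableV => //; case: dr.
rewrite (deriveV p0'); last by case: dr.
case: dr => _ ->; rewrite rmorph0 scale0r addr0 /GRing.scale /= -exprVn expr2.
by ring.
Qed.

End RealDerivative.

(** * The form with potential Phi *)

Section HermitianForm.
Variable R : realType.
Implicit Types (p q u v w : C2 R) (c : R[i]).

Lemma conjC_real (x : R) : (x%:C)^*%R = x%:C.
Proof. exact: conjc_real. Qed.

(* Polarization of [imxy]: sesquilinear, with [herm p p = imxy p]. *)
Definition herm p q : R[i] :=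
  - 'i / 2 * ((p.1 : R[i]) * (q.2 : R[i])^* - (p.2 : R[i]) * (q.1 : R[i])^*).

Lemma hermDl p q u : herm (p + q) u = herm p u + herm q u.
Proof. by rewrite /herm /=; ring. Qed.

Lemma hermDr p q u : herm u (p + q) = herm u p + herm u q.
Proof. by rewrite /herm /= !rmorphD; ring. Qed.

Lemma hermZl c p q : herm (c *: p) q = c * herm p q.
Proof. by rewrite /herm /= /GRing.scale /=; ring. Qed.

Lemma hermZr c p q : herm p (c *: q) = c^*%R * herm p q.
Proof. by rewrite /herm /= /GRing.scale /= !rmorphM; ring. Qed.

Lemma conj_herm p q : (herm p q)^*%R = herm q p.
Proof.
rewrite /herm; case: p q => [[a b] [c d]] [[a' b'] [c' d']] /=.
apply/eqP; rewrite eq_complex; apply/andP; split; apply/eqP => /=; by field.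
Qed.

Lemma herm_diag p : herm p p = (imxy p)%:C.
Proof.
rewrite /herm /imxy; case: p => [[a b] [c d]] /=.
apply/eqP; rewrite eq_complex; apply/andP; split; apply/eqP => /=; by field.
Qed.

Lemma herm_continuousl q : continuous (fun p => (herm p q : R[i]^o)).
Proof.
have fst1 : continuous (fun p : C2 R => (p.1 : R[i]^o)) by move=> p; exact: cvg_fst.
have snd1 : continuous (fun p : C2 R => (p.2 : R[i]^o)) by move=> p; exact: cvg_snd.
move=> p; apply: cvgM; first exact: cvg_cst.
apply: cvgB; (apply: cvgM; last exact: cvg_cst); [exact: fst1|exact: snd1].
Qed.

Lemma conjC_continuous : continuous (fun z : R[i]^o => ((z : R[i])^*%R : R[i]^o)).
Proof.
move=> z; apply/(@cvgrPdist_lt _ R[i]^o _ (nbhs (z : R[i]^o))) => e e0.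
have := nbhsx_ballx z e e0; rewrite -ball_normE.
by apply: filterS => s /=; rewrite -rmorphB /= norm_conjC.
Qed.

Lemma herm_continuousr q : continuous (fun p => (herm q p : R[i]^o)).
Proof.
move=> p; rewrite (_ : (fun p => _) = (fun p => ((herm p q)^*%R : R[i]^o))); last first.
  by apply/funext => r; rewrite conj_herm.
exact: (continuous_comp (@herm_continuousl q p) (@conjC_continuous _)).
Qed.

Lemma imxy_continuous : continuous (fun p => ((imxy p)%:C : R[i]^o)).
Proof.
move=> p; rewrite (_ : (fun p => _) = (fun p => (herm p p : R[i]^o))); last first.
  by apply/funext => r; rewrite herm_diag.
have fst1 : continuous (fun p : C2 R => (p.1 : R[i]^o)) by move=> ?; exact: cvg_fst.
have snd1 : continuous (fun p : C2 R => (p.2 : R[i]^o)) by move=> ?; exact: cvg_snd.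
have fstJ : continuous (fun p : C2 R => ((p.1 : R[i])^*%R : R[i]^o)).
  by move=> r; exact: (continuous_comp (fst1 r) (@conjC_continuous _)).
have sndJ : continuous (fun p : C2 R => ((p.2 : R[i])^*%R : R[i]^o)).
  by move=> r; exact: (continuous_comp (snd1 r) (@conjC_continuous _)).
apply: cvgM; first exact: cvg_cst.
by apply: cvgB; apply: cvgM; [exact: fst1|exact: sndJ|exact: snd1|exact: fstJ].
Qed.

Lemma open_domD : open (domD R).
Proof.
rewrite openE => p /= p0.
have e0 : 0 < (imxy p)%:C by rewrite ltcR.
have /cvgrPdist_lt /(_ _ e0) := @imxy_continuous p.
apply: filterS => q; rewrite -rmorphB /= normC_real ltcR ltr_norml => /andP[_].
by rewrite /domD /= ltrBlDl ltrDr.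
Qed.

End HermitianForm.

(** * Symbolic calculus for [Phi] and the Kähler axioms for its form *)

Section RationalExpressions.
Variable R : realType.
Implicit Types (p q u v w : C2 R) (c : R[i]).

(* Since [rexpr] is closed under [rexpr_deriv], the functions it denotes are
   smooth on [D], and every derivative of [Phi] is computed symbolically. *)
Inductive rexpr : Type :=
  | Cst of R[i]
  | HermL of C2 R
  | HermR of C2 R
  | Inv
  | Add of rexpr & rexpr
  | Mul of rexpr & rexpr.

Fixpoint reval (e : rexpr) p : R[i] :=
  match e with
  | Cst c => c
  | HermL q => herm p q
  | HermR q => herm q p
  | Inv => (Phi p)%:C
  | Add e1 e2 => reval e1 p + reval e2 p
  | Mul e1 e2 => reval e1 p * reval e2 p
  end.

Fixpoint rexpr_deriv v (e : rexpr) : rexpr :=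
  match e with
  | Cst _ => Cst 0
  | HermL q => Cst (herm v q)
  | HermR q => Cst (herm q v)
  | Inv => Mul (Mul (Cst (-1)) (Mul Inv Inv)) (Add (HermR v) (HermL v))
  | Add e1 e2 => Add (rexpr_deriv v e1) (rexpr_deriv v e2)
  | Mul e1 e2 => Add (Mul (rexpr_deriv v e1) e2) (Mul e1 (rexpr_deriv v e2))
  end.

(** On a real line the Hermitian form is a quadratic polynomial in [t], and the derivative at 0 is
    its linear coefficient. *)
Lemma has_rderive_imxy v p :
  has_rderive (fun q => (imxy q)%:C) v p (herm v p + herm p v).
Proof.
apply: (@has_rderive_quadratic _ _ _ _ _ _ (herm v v)) => t.
by rewrite -!herm_diag hermDl !hermDr !hermZl !hermZr conjC_real; ring.
Qed.

Lemma has_rderive_reval e v p : domD R p ->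
  has_rderive (reval e) v p (reval (rexpr_deriv v e) p).
Proof.
move=> Dp; elim: e => [c|q|q||e1 IH1 e2 IH2|e1 IH1 e2 IH2].
- by apply: (@has_rderive_quadratic _ _ _ _ _ _ 0) => t /=; ring.
- by apply: (@has_rderive_quadratic _ _ _ _ _ _ 0) => t /=;
    rewrite hermDl hermZl; ring.
- by apply: (@has_rderive_quadratic _ _ _ _ _ _ 0) => t /=;
    rewrite hermDr hermZr conjC_real; ring.
- have := has_rderive_inv_real (lt0r_neq0 Dp) (has_rderive_imxy v p).
  by rewrite /= mulN1r expr2.
- exact: has_rderiveD.
- exact: has_rderiveM.
Qed.

Lemma reval_continuous e : {in domD R, continuous (reval e : C2 R -> R[i]^o)}.
Proof.
move=> p; rewrite inE => Dp; elim: e => [c|q|q||e1 IH1 e2 IH2|e1 IH1 e2 IH2].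
- exact: cvg_cst.
- exact: herm_continuousl.
- exact: herm_continuousr.
- rewrite /continuous_at /= /Phi fmorphV.
  rewrite (_ : (fun _ => _) = fun q => ((imxy q)%:C)^-1); last first.
    by apply/funext => q; rewrite /= fmorphV.
  apply: cvgV; first by apply: lt0r_neq0; rewrite ltcR.
  exact: imxy_continuous.
- exact: (@cvgD _ R[i]^o _ _ _ (reval e1) (reval e2) _ _ IH1 IH2).
- exact: (@cvgM _ _ _ _ (reval e1 : _ -> R[i]^o) (reval e2 : _ -> R[i]^o) _ _ IH1 IH2).
Qed.

Lemma Cn_reval n e : Cn n (domD R) (reval e).
Proof.
elim: n e => [|n IHn] e; first by split=> //; exact: reval_continuous.
split; first exact: reval_continuous.
move=> v; split=> [p Dp|]; first exact: has_rderive_rderivable (has_rderive_reval _ _ Dp).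
apply: Cn_ext (IHn (rexpr_deriv v e)); first exact: open_domD.
by move=> p; rewrite inE => Dp; exact: has_rderiveE (has_rderive_reval _ _ Dp).
Qed.

(** The part of the differential of [Phi] that is antilinear in [v]; the factor [HermL v] is
    holomorphic in the base point. *)
Definition delbar_expr v : rexpr := Mul (Mul (Cst (-1)) (Mul Inv Inv)) (HermL v).

Lemma delbar_Phi v p : domD R p ->
  delbar (fun q => (Phi q)%:C) v p = reval (delbar_expr v) p.
Proof.
move=> Dp.
have E w : rderive (fun q => (Phi q)%:C) w p = reval (rexpr_deriv w Inv) p.
  exact: has_rderiveE (has_rderive_reval Inv w Dp).
have /del_delbarE H : rderive (fun q => (Phi q)%:C) v p
    = - (Phi p)%:C ^+ 2 * herm v p + - (Phi p)%:C ^+ 2 * herm p v.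
  by rewrite E /=; ring.
rewrite (H _).2 /=; first by ring.
by rewrite E /= hermZl hermZr conjCi; ring.
Qed.

(** The (1,1) part of the Hessian of [Phi], linear in [u] and antilinear in [v]: the first summand
    comes from differentiating [Phi ^ 2] in [delbar_expr v], the second from differentiating its
    factor [HermL v]. *)
Definition levi u v : rexpr :=
  Add (Mul (Cst 2) (Mul (Mul Inv (Mul Inv Inv)) (Mul (HermR u) (HermL v))))
      (Mul (Cst (- herm u v)) (Mul Inv Inv)).

Lemma del_delbar_Phi u v p : domD R p ->
  del (delbar (fun q => (Phi q)%:C) v) u p = reval (levi u v) p.
Proof.
move=> Dp.
have E w : rderive (delbar (fun q => (Phi q)%:C) v) w p
    = reval (rexpr_deriv w (delbar_expr v)) p.
  apply: has_rderiveE.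
  apply: (has_rderive_ext (@open_domD R) Dp _ (has_rderive_reval _ w Dp)).
  by move=> q; rewrite inE; exact: delbar_Phi.
(* The second summand is the part antilinear in [u], a (0,2) derivative, which [del] discards. *)
have /del_delbarE H : rderive (delbar (fun q => (Phi q)%:C) v) u p
    = reval (levi u v) p + 2 * (Phi p)%:C ^+ 3 * (herm p u * herm p v).
  by rewrite E /=; ring.
by rewrite (H _).1//= E /= !(hermZl, hermZr) conjCi; ring.
Qed.

Definition omega_expr u v : rexpr :=
  Mul (Cst ('i / 2)) (Add (levi u v) (Mul (Cst (-1)) (levi v u))).

Lemma omega_tildeE u v p : domD R p -> omega_tilde R p u v = reval (omega_expr u v) p.
Proof.
move=> Dp; rewrite /omega_tilde /kahler_of_potential /del_delbar.
by rewrite !del_delbar_Phi//= mulN1r.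
Qed.

Lemma conj_levi u v p : (reval (levi u v) p)^*%R = reval (levi v u) p.
Proof.
rewrite /=; move: (conj_herm u p) (conj_herm p v) (conj_herm u v).
move: (herm u p) (herm p u) (herm p v) (herm v p) (herm u v) (herm v u) (Phi p).
move=> a a' b b' c c' x ha hb hc.
by rewrite !(rmorphD, rmorphM, rmorphN, rmorph1) /= ha hb hc conjC_real; ring.
Qed.

(** Exchanging [u] and [v] conjugates the Levi form, so the antisymmetrization is [2 'i] times its
    imaginary part. [omega0E] has the same shape, which reduces the pullback identity to one between
    Hermitian forms. *)
Lemma omega_tilde_Im u v p : domD R p ->
  omega_tilde R p u v = (- complex.Im (reval (levi u v) p))%:C.
Proof.
move=> Dp; rewrite omega_tildeE//.
have -> : reval (omega_expr u v) p
    = 'i / 2 * (reval (levi u v) p - reval (levi v u) p) by rewrite /= mulN1r.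
rewrite -(conj_levi u v) subcJ complexiE rmorphN.
move: (reval (levi u v) p) => z.
rewrite (_ : _ * _ = 'i ^+ 2 * (complex.Im z)%:C); last by field.
by rewrite sqrCi mulN1r.
Qed.

Lemma closed_omega_tilde : closed_2form (domD R) (omega_tilde R).
Proof.
move=> p Dp u v w.
have E u' v' w' : rderive (fun q => omega_tilde R q u' v') w' p
    = reval (rexpr_deriv w' (omega_expr u' v')) p.
  apply: has_rderiveE.
  apply: (has_rderive_ext (@open_domD R) Dp _ (has_rderive_reval _ w' Dp)).
  by move=> q; rewrite inE; exact: omega_tildeE.
move: (omega_tilde R) E => omega E.
rewrite !E {E} /omega_expr /levi; cbn [reval rexpr_deriv].
(* The cyclic sum vanishes as a polynomial in these thirteen scalars, taken as independent
   variables. *)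
move: (herm u p) (herm p u) (herm v p) (herm p v) (herm w p) (herm p w)
  (herm u v) (herm v u) (herm u w) (herm w u) (herm v w) (herm w v) ((Phi p)%:C).
move=> a1 a2 b1 b2 c1 c2 d1 d2 e1 e2 f1 f2 x; move: ('i / 2) => k.
by ring.
Qed.

Lemma smooth_omega_tilde u v : smooth_on (domD R) (fun p => omega_tilde R p u v).
Proof.
move=> n; apply: Cn_ext (Cn_reval n (omega_expr u v)); first exact: open_domD.
by move=> q; rewrite inE; exact: omega_tildeE.
Qed.

Lemma is_2form_omega_tilde : is_2form (domD R) (omega_tilde R).
Proof.
move=> p Dp; split=> [u v|t u v w]; rewrite !omega_tildeE//=; first by ring.
by rewrite !(hermDl, hermDr, hermZl, hermZr) conjC_real; ring.
Qed.

Lemma real_11form_omega_tilde : is_real_11form (domD R) (omega_tilde R).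
Proof.
move=> p Dp u v; rewrite !omega_tilde_Im// complex_real eqxx; split=> //.
congr (- complex.Im _)%:C.
transitivity (- 'i ^+ 2 * reval (levi u v) p); last by rewrite sqrCi opprK mul1r.
by rewrite /levi; cbn [reval]; rewrite !(hermZl, hermZr) conjCi; ring.
Qed.

(** With [a = herm v p] and [b] the determinant of [v] and [p], the signature (1,1) gives a reversed
    Cauchy-Schwarz identity, [|b|^2 / 4 = |a|^2 - herm p p * herm v v]. It turns the metric into
    [Phi^3 (|a|^2 + |b|^2 / 4)]. *)
Lemma positive_omega_tilde : positive_2form (domD R) (omega_tilde R).
Proof.
move=> p Dp v v0.
have p0 : 0 < (imxy p)%:C by rewrite ltcR.
pose a := herm v p; pose b : R[i] := (v.1 : R[i]) * p.2 - (v.2 : R[i]) * p.1.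
(* [a = b = 0] is a linear system in [v.1], [v.2] whose determinant is, up to sign, the number [d0]
   below, a nonzero multiple of [herm p p]; Cramer's rule then gives [v = 0]. *)
have ab0 : (a != 0) || (b != 0).
  apply: contraNT v0; rewrite negb_or !negbK => /andP[/eqP a0 /eqP b0].
  have i0 : - 'i / 2 != 0 :> R[i].
    by rewrite mulf_neq0 ?invr_eq0 ?pnatr_eq0// oppr_eq0 eq_complex /= oner_eq0 andbF.
  have c0 : (v.1 : R[i]) * (p.2 : R[i])^* - (v.2 : R[i]) * (p.1 : R[i])^* = 0.
    by move/eqP: a0; rewrite /a /herm mulf_eq0 (negbTE i0) => /eqP.
  have d0 : (p.1 : R[i]) * (p.2 : R[i])^* - (p.2 : R[i]) * (p.1 : R[i])^* != 0.
    by apply: contraTneq p0; rewrite -herm_diag /herm => ->; rewrite mulr0 ltxx.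
  have v10 : v.1 = 0.
    apply/eqP; rewrite -(mulIr_eq0 _ (mulIf d0)); apply/eqP.
    rewrite [LHS](_ : _ = (p.1 : R[i]) * 0 - (p.1 : R[i])^*%R * 0); last first.
      by rewrite -{1}c0 -b0 /b; ring.
    by rewrite !mulr0 subr0.
  have v20 : v.2 = 0.
    apply/eqP; rewrite -(mulIr_eq0 _ (mulIf d0)); apply/eqP.
    rewrite [LHS](_ : _ = (p.2 : R[i]) * 0 - (p.2 : R[i])^*%R * 0); last first.
      by rewrite -{1}c0 -b0 /b; ring.
    by rewrite !mulr0 subr0.
  by case: (v) v10 v20 => v1 v2 /= -> ->.
have -> : omega_tilde R p v ('i *: v)
    = (Phi p)%:C ^+ 3 * (`|a| ^+ 2 + `|b| ^+ 2 / 4).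
  rewrite omega_tildeE//= !(hermZl, hermZr) conjCi !normCK /a conj_herm.
  have i2 : 'i * 'i = -1 :> R[i] by rewrite -expr2 sqrCi.
  rewrite [LHS](_ : _ = - ('i * 'i) * (Phi p)%:C ^+ 2 *
     (2 * (Phi p)%:C * (herm v p * herm p v) - herm v v)); last by field.
  have Pp : (Phi p)%:C * herm p p = 1.
    by rewrite herm_diag /Phi -rmorphM /= mulVf// gt_eqF.
  rewrite i2 opprK mul1r.
  (* Inserting [Phi * herm p p = 1] gives every term the common factor [Phi ^ 3]. *)
  rewrite (_ : herm v v = (Phi p)%:C * herm p p * herm v v); last by rewrite Pp mul1r.
  rewrite (_ : b * b^*%R / 4 = herm v p * herm p v - herm p p * herm v v); last first.
    rewrite /b !(rmorphB, rmorphM) /= /herm.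
    rewrite [RHS](_ : _ = ('i * 'i) / 4 * - (((v.1 : R[i]) * p.2 - (v.2 : R[i]) * p.1)
      * ((v.1 : R[i])^*%R * (p.2 : R[i])^*%R - (v.2 : R[i])^*%R * (p.1 : R[i])^*%R)));
      last by field.
    by rewrite i2; field.
  by ring.
have sum0 : 0 < `|a| ^+ 2 + `|b| ^+ 2 / 4.
  case/orP: ab0 => h.
    by rewrite ltr_pwDl// ?exprn_gt0 ?normr_gt0// divr_ge0 ?exprn_ge0.
  by rewrite ltr_pwDr// ?exprn_ge0// divr_gt0 ?exprn_gt0 ?normr_gt0.
by rewrite mulr_gt0// exprn_gt0// ltcR invr_gt0.
Qed.

Lemma kahler_domain_omega_tilde : kahler_domain (domD R) (omega_tilde R).
Proof.
split; first exact: open_domD.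
split; [exact: is_2form_omega_tilde|exact: smooth_omega_tilde
  |exact: real_11form_omega_tilde|exact: closed_omega_tilde
  |exact: positive_omega_tilde].
Qed.

End RationalExpressions.

(** * The flat form of l^2 *)

Section Ell2InnerProduct.
Variable R : realType.
Implicit Types (x y z u v : ell2 R) (c : R[i]).

Lemma ell2_square_summable x : square_summable x.
Proof. by case: x => x /= /asboolP. Qed.

Lemma ell2D x y n : (x + y) n = x n + y n.
Proof. by []. Qed.

Lemma ell2Z c x n : (c *: x) n = c * x n.
Proof. by []. Qed.

Definition ell2_reterm x y : nat -> R := fun n => complex.Re (x n * (y n)^*%R).

(** Absolute convergence, from [|x_n| |y_n| <= |x_n|^2 + |y_n|^2]. *)
Lemma is_cvg_ell2_reterm x y : cvgn (series (ell2_reterm x y)).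
Proof.
apply: normed_cvg; apply: (@series_le_cvg _ _ (sqnorm x + sqnorm y)).
- by move=> n; exact: normr_ge0.
- by move=> n; rewrite addr_ge0 ?sqnorm_ge0.
- move=> n; apply: (@le_trans _ _ (normc (x n) * normc (y n))).
    rewrite -lecR; apply: (le_trans (normc_ge_Re _)).
    by rewrite normrM norm_conjC rmorphM.
  rewrite fctE /sqnorm.
  have : 0 <= (normc (x n) - normc (y n)) ^+ 2 by exact: sqr_ge0.
  have := normc_ge0 (x n); have := normc_ge0 (y n); nra.
- by apply: is_cvg_seriesD; exact: ell2_square_summable.
Qed.

Definition ell2_redot x y : R := limn (series (ell2_reterm x y)).

Lemma ell2_redotC x y : ell2_redot x y = ell2_redot y x.
Proof.
congr (limn (series _)); apply/funext => n; rewrite /ell2_reterm.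
by case: (x n) (y n) => a b [c d] /=; ring.
Qed.

Lemma ell2_redotDl x y z : ell2_redot (x + y) z = ell2_redot x z + ell2_redot y z.
Proof.
rewrite /ell2_redot -lim_seriesD; [|exact: is_cvg_ell2_reterm..].
congr (limn (series _)); apply/funext => n.
by rewrite !fctE /ell2_reterm ell2D mulrDl raddfD.
Qed.

Lemma ell2_redotZl (t : R) x y : ell2_redot (t%:C *: x) y = t * ell2_redot x y.
Proof.
rewrite /ell2_redot -[RHS]/(t *: limn _) -lim_seriesZ; last exact: is_cvg_ell2_reterm.
congr (limn (series _)); apply/funext => n; rewrite !fctE /ell2_reterm ell2Z.
by case: (x n) (y n) => a b [c d]; rewrite /GRing.scale /=; ring.
Qed.

Lemma ell2_redotii x y : ell2_redot ('i *: x) ('i *: y) = ell2_redot x y.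
Proof.
congr (limn (series _)); apply/funext => n; rewrite /ell2_reterm !ell2Z rmorphM /=.
by rewrite mulrACA conjCi mulrN -expr2 sqrCi opprK mul1r.
Qed.

Lemma l2norm_sqr x : l2norm x ^+ 2 = ell2_redot x x.
Proof.
rewrite /l2norm sqr_sqrtr; last exact/lim_series_sqnorm_ge0/ell2_square_summable.
congr (limn (series _)); apply/funext => n; rewrite /ell2_reterm /sqnorm.
case: (x n) => a b /=; rewrite sqr_sqrtr; first by ring.
by rewrite addr_ge0 ?sqr_ge0.
Qed.

(** The Hermitian product, linear in [x], rebuilt from its real part: the imaginary part of [<x, y>]
    is the real part of [<x, 'i y>]. Only real series are ever summed. *)
Definition ell2_dot x y : R[i] :=
  (ell2_redot x y)%:C + 'i * (ell2_redot x ('i *: y))%:C.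

Lemma ell2_redotDr x y z : ell2_redot z (x + y) = ell2_redot z x + ell2_redot z y.
Proof. by rewrite !(ell2_redotC z) ell2_redotDl. Qed.

Lemma ell2_redotZr (t : R) x y : ell2_redot y (t%:C *: x) = t * ell2_redot y x.
Proof. by rewrite !(ell2_redotC y) ell2_redotZl. Qed.

Lemma ell2_redotNr x y : ell2_redot y (- x) = - ell2_redot y x.
Proof. by rewrite -scaleN1r -(rmorph1 (real_complex R)) -rmorphN ell2_redotZr mulN1r. Qed.

Lemma ell2_redotil x y : ell2_redot ('i *: x) y = - ell2_redot x ('i *: y).
Proof.
by rewrite -ell2_redotii scalerA -expr2 sqrCi scaleN1r ell2_redotC ell2_redotNr ell2_redotC.
Qed.

Lemma ell2_dotDl x y z : ell2_dot (x + y) z = ell2_dot x z + ell2_dot y z.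
Proof. by rewrite /ell2_dot !ell2_redotDl !rmorphD; ring. Qed.

Lemma ell2_dotil x y : ell2_dot ('i *: x) y = 'i * ell2_dot x y.
Proof.
rewrite /ell2_dot ell2_redotil ell2_redotii rmorphN mulrDr [in RHS]mulrA -expr2 sqrCi.
by ring.
Qed.

Lemma ell2_dotZl c x y : ell2_dot (c *: x) y = c * ell2_dot x y.
Proof.
have realZ (t : R) z : ell2_dot (t%:C *: z) y = t%:C * ell2_dot z y.
  by rewrite /ell2_dot !ell2_redotZl !rmorphM; ring.
rewrite {1}[c]complexE complexiE scalerDl ell2_dotDl -scalerA ell2_dotil !realZ.
by rewrite {3}[c]complexE complexiE; ring.
Qed.

Lemma conj_ell2_dot x y : (ell2_dot x y)^*%R = ell2_dot y x.
Proof.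
rewrite /ell2_dot rmorphD rmorphM /= !conjC_real conjCi ell2_redotC; congr (_ + _).
by rewrite (ell2_redotC y) ell2_redotil rmorphN mulrN mulNr.
Qed.

Lemma ell2_dotDr x y z : ell2_dot z (x + y) = ell2_dot z x + ell2_dot z y.
Proof. by rewrite -!(conj_ell2_dot _ z) ell2_dotDl rmorphD. Qed.

Lemma ell2_dotZr c x y : ell2_dot y (c *: x) = c^*%R * ell2_dot y x.
Proof. by rewrite -!(conj_ell2_dot _ y) ell2_dotZl rmorphM. Qed.

(** Serves the Gram entries of the power sequences, each of which is a complex constant times a real
    power series in [|w|^2]. *)
Lemma ell2_dot_sum x y c (s : nat -> R) (l : R) :
  (forall n, x n * (y n)^*%R = c * (s n)%:C) -> series s @ \oo --> l ->
  ell2_dot x y = c * l%:C.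
Proof.
move=> xy sl.
have lims (t : R) : limn (series (t *: s)) = t * l.
  rewrite lim_seriesZ; last by apply/cvg_ex; exists l.
  by rewrite (cvg_lim _ sl).
have -> : ell2_dot x y = (complex.Re c * l)%:C + 'i * (complex.Im c * l)%:C.
  rewrite /ell2_dot /ell2_redot -!lims.
  congr (_%:C + _ * _%:C); congr (limn (series _)); apply/funext => n.
    by rewrite /ell2_reterm xy; case: (c) => a b /=; rewrite mulr0 subr0.
  rewrite /ell2_reterm ell2Z rmorphM /= mulrCA xy conjCi -complexiE.
  by rewrite -[RHS]/(complex.Im c * s n); case: (c) => a b /=; ring.
by rewrite !rmorphM [in RHS](complexE c) complexiE; ring.
Qed.

Lemma rderive_l2norm_sqr v x :
  rderive (fun y : ell2 R => (l2norm y ^+ 2)%:C) v x = (2 * ell2_redot x v)%:C.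
Proof.
apply: has_rderiveE.
apply: (@has_rderive_quadratic _ _ _ _ _ _ (ell2_redot v v)%:C) => t.
rewrite !l2norm_sqr ell2_redotDl !ell2_redotDr !ell2_redotZr !ell2_redotZl.
by rewrite (ell2_redotC v x) !(rmorphD, rmorphM, rmorph1); ring.
Qed.

Lemma delbar_l2norm_sqr v x :
  delbar (fun y : ell2 R => (l2norm y ^+ 2)%:C) v x = ell2_dot x v.
Proof.
by rewrite /delbar !rderive_l2norm_sqr /ell2_dot !rmorphM; field.
Qed.

(** [delbar] of the squared norm is linear in the base point, so its derivative no longer depends on
    [z]: the Levi form of the flat potential is the inner product itself. *)
Lemma omega0E z u v : omega0 z u v = (- complex.Im (ell2_dot u v))%:C.
Proof.
have E w w' : rderive (delbar (fun y : ell2 R => (l2norm y ^+ 2)%:C) w) w' z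
    = ell2_dot w' w.
  apply: has_rderiveE; apply: (@has_rderive_quadratic _ _ _ _ _ _ 0) => t.
  by rewrite !delbar_l2norm_sqr ell2_dotDl ell2_dotZl; ring.
have D w w' : del (delbar (fun y : ell2 R => (l2norm y ^+ 2)%:C) w) w' z = ell2_dot w' w.
  by rewrite /del !E ell2_dotZl mulrA -expr2 sqrCi mulN1r opprK; field.
rewrite /omega0 /kahler_of_potential /del_delbar; move: (delbar _) D {E} => F D.
rewrite !D -(conj_ell2_dot u v) subcJ complexiE rmorphN.
rewrite (_ : _ * _ = 'i ^+ 2 * (complex.Im (ell2_dot u v))%:C); last by field.
by rewrite sqrCi mulN1r.
Qed.

End Ell2InnerProduct.

(** * The power sequence as a holomorphic map into l^2 *)

Section GeometricBounds.
Variable R : realType.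
Implicit Types r s C K M : R.

(** The quotient of the right side by [1 - s] is a geometric sum of [n + 1] terms, each at least
    [s ^ n]. *)
Lemma mulr_nat_expr_le (s : R) n : 0 <= s -> s <= 1 ->
  n.+1%:R * s ^+ n * (1 - s) <= 1 - s ^+ n.+1.
Proof.
move=> s0 s1; elim: n => [|n IHn]; first by rewrite expr0 expr1 !mul1r.
have t1 : 0 <= s ^+ n.+1 <= 1 by rewrite exprn_ge0//= exprn_ile1.
rewrite -natr1 [s ^+ n.+2]exprS; move: t1 IHn; rewrite exprS.
move: (n.+1%:R) (s ^+ n) => a t; nra.
Qed.

(** Taking [s = 1 - (1 - r) / 3] gives [r <= s ^ 3] by Bernoulli. Two of the three factors [s ^ n]
    absorb [n ^ 2], since [(n + 1) s ^ n <= 1 / d]; the third remains as the majorant. The factor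
    [1 / s] in [C] pays for the exponent [n - 1]. *)
Lemma sqr_nat_expr_bound (r : R) : 0 <= r -> r < 1 ->
  exists C s : R, [/\ 0 < C, 0 < s, s < 1
    & forall n, n%:R ^+ 2 * r ^+ n.-1 <= C * s ^+ n].
Proof.
move=> r0 r1; pose d := (1 - r) / 3; pose s := 1 - d.
have d0 : 0 < d by rewrite /d; lra.
have s0 : 0 < s by rewrite /s /d; lra.
have s1 : s < 1 by rewrite /s; lra.
have rs : r <= s ^+ 3.
  have : r = 1 - 3 * d by rewrite /d; lra.
  rewrite /s => ->; have : 0 <= d ^+ 2 * (3 - d) by rewrite mulr_ge0 ?sqr_ge0// /d; lra.
  by lra.
exists (d ^- 2 * s^-1), s; split=> //; first by rewrite mulr_gt0 ?invr_gt0 ?exprn_gt0.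
case=> [|n]; first by rewrite expr0n mul0r !mulr_ge0 ?invr_ge0 ?exprn_ge0// ltW.
rewrite (exprS s) mulrA divfK ?gt_eqF//=.
have h : n.+1%:R * s ^+ n <= d^-1.
  rewrite -[leRHS]mul1r ler_pdivlMr//.
  have := mulr_nat_expr_le n (ltW s0) (ltW s1).
  rewrite (_ : 1 - s = d); last by rewrite /s; lra.
  by move/le_trans; apply; rewrite gerBl exprn_ge0// ltW.
apply: (@le_trans _ _ (n.+1%:R ^+ 2 * (s ^+ 3) ^+ n)).
  by rewrite ler_wpM2l ?sqr_ge0// lerXn2r// nnegrE exprn_ge0// ltW.
rewrite -exprM mulnC exprM (_ : _ * _ = (n.+1%:R * s ^+ n) ^+ 2 * s ^+ n); last by ring.
apply: ler_wpM2r; first by rewrite exprn_ge0// ltW.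
have ns0 : 0 <= n.+1%:R * s ^+ n by rewrite mulr_ge0// exprn_ge0// ltW.
by rewrite -exprVn lerXn2r// nnegrE; exact: le_trans h.
Qed.

Lemma is_cvg_series_le_geometric (x : nat -> R) C s : 0 <= s -> s < 1 -> 0 <= C ->
  (forall n, 0 <= x n <= C * s ^+ n) -> cvgn (series x).
Proof.
move=> s0 s1 C0 xC; apply: (@series_le_cvg _ _ (geometric C s)).
- by move=> n; case/andP: (xC n).
- by move=> n; rewrite mulr_ge0 ?exprn_ge0.
- by move=> n; case/andP: (xC n).
- by apply: is_cvg_geometric_series; rewrite ger0_norm.
Qed.

(** Summing the recurrence gives [L = r * L + l] for the sum [L] of [x]. Applied twice, this
    evaluates the two derived series from the geometric one without differentiating a power
    series. *)
Lemma cvg_series_affine_recurrence (x y : nat -> R) (r l : R) : r < 1 -> x 0%N = 0 ->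
  (forall n, x n.+1 = r * x n + y n) -> cvgn (series x) -> series y @ \oo --> l ->
  series x @ \oo --> l / (1 - r).
Proof.
move=> r1 x0 xS cx cy.
have [L xL] : exists L : R, series x @ \oo --> L by exists (limn (series x)).
suff -> : l / (1 - r) = L by [].
have H1 : (fun n => series x n.+1) @ \oo --> L by rewrite cvg_shiftS.
have H2 : (fun n => series x n.+1) @ \oo --> r * L + l.
  rewrite (_ : (fun n => _) = (fun n => r * series x n + series y n)).
    by apply: cvgD => //; apply: cvgM => //; exact: cvg_cst.
  apply/funext => n; rewrite /series /= big_nat_recl// x0 add0r mulr_sumr -big_split /=.
  exact: eq_bigr.
have LE : L = r * L + l by exact: (cvg_unique _ H1 H2).
have -> : l = L * (1 - r) by lra.
by rewrite mulfK// gt_eqF// subr_gt0.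
Qed.

Lemma cvg_series_expr r : 0 <= r -> r < 1 ->
  series (fun n => r ^+ n) @ \oo --> (1 - r)^-1.
Proof.
move=> r0 r1; have := @cvg_geometric_series _ 1 r; rewrite ger0_norm// => /(_ r1).
rewrite mul1r (_ : geometric 1 r = (fun n => r ^+ n))//.
by apply/funext => n; rewrite /geometric /= mul1r.
Qed.

Lemma cvg_series_nat_expr r : 0 <= r -> r < 1 ->
  series (fun n => n%:R * r ^+ n.-1) @ \oo --> (1 - r) ^- 2.
Proof.
move=> r0 r1; have [C [s [C0 s0 s1 h]]] := sqr_nat_expr_bound r0 r1.
rewrite expr2 invfM; apply: (@cvg_series_affine_recurrence _ (fun n => r ^+ n)).
- by [].
- by rewrite mul0r.
(* The index 0 is separate because [0.-1 = 0], so that [r * r ^+ n.-1] is [r ^+ n] only from index 1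
   on. *)
- case=> [|n] /=; first by rewrite expr0 mul0r mulr0 add0r mulr1.
  by rewrite -[n.+2%:R]natr1 (exprS r); ring.
- apply: (@is_cvg_series_le_geometric _ C s); rewrite ?ltW// => n.
  rewrite mulr_ge0 ?exprn_ge0//=; apply: le_trans (h n).
  rewrite ler_wpM2r ?exprn_ge0// expr2 -natrM ler_nat.
  by case: n => // n; rewrite leq_pmulr.
- exact: cvg_series_expr.
Qed.

Lemma cvg_series_sqr_nat_expr r : 0 <= r -> r < 1 ->
  series (fun n => n%:R ^+ 2 * r ^+ n.-1) @ \oo --> (1 + r) / (1 - r) ^+ 3.
Proof.
move=> r0 r1; have [C [s [C0 s0 s1 h]]] := sqr_nat_expr_bound r0 r1.
have r10 : 1 - r != 0 by rewrite subr_eq0 gt_eqF.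
rewrite (_ : _ / _ = (2 * r * (1 - r) ^- 2 + (1 - r)^-1) / (1 - r)); last by field.
apply: (@cvg_series_affine_recurrence _
  (fun n => 2 * r * (n%:R * r ^+ n.-1) + r ^+ n)).
- by [].
- by rewrite expr0n mul0r.
- case=> [|n] /=; first by rewrite expr0 expr0n !(mul0r, mulr0, add0r) expr1n mulr1.
  by rewrite -[n.+2%:R]natr1 (exprS r); ring.
- apply: (@is_cvg_series_le_geometric _ C s); rewrite ?ltW// => n.
  by rewrite mulr_ge0 ?exprn_ge0//=.
- rewrite (_ : series _ = (fun n => 2 * r * series (fun n => n%:R * r ^+ n.-1) n
      + series (fun n => r ^+ n) n)).
    apply: cvgD; last exact: cvg_series_expr.
    by apply: cvgM; [exact: cvg_cst|exact: cvg_series_nat_expr].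
  by apply/funext => n; rewrite /series /= big_split /= mulr_sumr.
Qed.

End GeometricBounds.

(** A quadratic remainder is little-o of the increment. It serves [powseq], and also the linear
    coordinates, whose remainder is zero. *)
Lemma is_diff_quadratic (K : numFieldType) (V W : normedModType K)
    (f df : V -> W) (x : V) (M r : K) :
  linear df -> continuous df -> 0 < M -> 0 < r ->
  (forall h, `|h| < r -> `|f (h + x) - f x - df h| <= M * `|h| ^+ 2) ->
  is_diff x f df.
Proof.
move=> lin cont M0 r0 fM.
pose dfM := GRing.isLinear.Build _ _ _ _ _ lin.
pose dfL : {linear V -> W} := HB.pack df dfM.
have fo : f \o shift x = cst (f x) + dfL +o_ 0 id.
  apply/eqaddoP => e e0; near=> h.
  rewrite !fctE opprD addrA /=.
  have hr : `|h| < r.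
    by near: h; apply: nbhs0_lt.
  apply: le_trans (fM h hr) _; rewrite expr2 mulrA ler_wpM2r// mulrC -ler_pdivlMr//.
  by near: h; apply: nbhs0_le; rewrite divr_gt0.
have dE : 'd f x = df :> (V -> W) by exact: (@diff_unique _ _ _ _ dfL).
by apply: DiffDef => //; apply/diff_locallyP; rewrite dE.
Unshelve. all: by end_near. Qed.

(** * Differentiability and Gram matrix of the power sequence *)

Section PowerSequence.
Variable R : realType.
Implicit Types (w z : R[i]^o).

Lemma normcX (c : R[i]) n : normc (c ^+ n) = normc c ^+ n.
Proof. by apply: complexI; rewrite rmorphXn; exact: normrX. Qed.

Lemma normc_nat n : normc (n%:R : R[i]) = n%:R.
Proof. by apply: complexI; rewrite rmorph_nat; exact: normr_nat. Qed.

Lemma square_summable_le_geometric (x : nat -> R[i]) (C s : R) :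
  0 <= s -> s < 1 -> 0 <= C -> (forall n, normc (x n) <= C * s ^+ n) ->
  square_summable x.
Proof.
move=> s0 s1 C0 xC.
apply: (@is_cvg_series_le_geometric _ _ (C ^+ 2) (s ^+ 2)); rewrite ?sqr_ge0//.
  by rewrite expr_lt1.
move=> n; rewrite sqnorm_ge0 -exprM mulnC exprM -exprMn /sqnorm /=.
by rewrite lerXn2r// nnegrE ?normc_ge0// mulr_ge0// exprn_ge0.
Qed.

(** [M] is the norm of the sequence [s ^ n]. Its independence of [x] and [C] lets [C] carry the
    factor [|h|^2] of a Taylor remainder. *)
Lemma l2norm_le_geometric (s : R) : 0 <= s -> s < 1 ->
  exists2 M : R, 0 < M & forall (x : ell2 R) (C : R), 0 <= C ->
    (forall n, normc (x n) <= C * s ^+ n) -> l2norm x <= C * M.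
Proof.
move=> s0 s1; have s21 : s ^+ 2 < 1 by rewrite expr_lt1.
exists (Num.sqrt (1 - s ^+ 2)^-1); first by rewrite sqrtr_gt0 invr_gt0 subr_gt0.
move=> x C C0 xC; rewrite -[C]ger0_norm// -sqrtr_sqr -sqrtrM ?sqr_ge0//.
apply: ler_wsqrtr.
have cg := @cvg_geometric_series _ (C ^+ 2) (s ^+ 2).
rewrite ger0_norm ?sqr_ge0// in cg; rewrite -(cvg_lim _ (cg s21))//.
apply: lim_series_le; first exact: ell2_square_summable.
  by apply: is_cvg_geometric_series; rewrite ger0_norm ?sqr_ge0.
move=> n; rewrite /geometric /= -exprM mulnC exprM -exprMn /sqnorm.
by rewrite lerXn2r// nnegrE ?normc_ge0// mulr_ge0// exprn_ge0.
Qed.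

(* Both sequences are square summable, hence not replaced by the default value
   [0], only for [|w| < 1]. *)
Definition powseq w : ell2 R := insubd 0 (fun n => (w : R[i]) ^+ n).

Definition dpowseq w : ell2 R := insubd 0 (fun n => n%:R * (w : R[i]) ^+ n.-1).

Lemma powseqE w n : normc w < 1 -> powseq w n = (w : R[i]) ^+ n.
Proof.
move=> w1; rewrite /powseq insubdK//; apply/asboolP.
apply: (@square_summable_le_geometric _ 1 (normc w)); rewrite ?normc_ge0//.
by move=> m; rewrite mul1r normcX.
Qed.

Lemma dpowseqE w n : normc w < 1 -> dpowseq w n = n%:R * (w : R[i]) ^+ n.-1.
Proof.
move=> w1; rewrite /dpowseq insubdK//; apply/asboolP.
have [C [s [C0 s0 s1 h]]] := sqr_nat_expr_bound (normc_ge0 w) w1.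
apply: (@square_summable_le_geometric _ C s); rewrite ?ltW// => m.
apply: le_trans (h m); rewrite ComplexField.Normc.normcM normcX normc_nat.
rewrite ler_wpM2r ?exprn_ge0 ?normc_ge0// expr2 -natrM ler_nat.
by case: m => // m; rewrite leq_pmulr.
Qed.

(** The mean value bound [n r^(n-1) |z - w|], multiplied by [r] to keep the exponent [n - 1] out of
    the induction. *)
Lemma normc_exprB (w z : R[i]) (r : R) n : normc w <= r -> normc z <= r ->
  r * normc (z ^+ n - w ^+ n) <= normc (z - w) * (n%:R * r ^+ n).
Proof.
move=> wr zr; have r0 : 0 <= r := le_trans (normc_ge0 w) wr.
elim: n => [|n IHn]; first by rewrite !expr0 subrr ComplexField.Normc.normc0 mulr0 mul0r mulr0.
have -> : z ^+ n.+1 - w ^+ n.+1 = z * (z ^+ n - w ^+ n) + (z - w) * w ^+ n.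
  by rewrite !exprS; ring.
have h := le_normcD (z * (z ^+ n - w ^+ n)) ((z - w) * w ^+ n).
rewrite !ComplexField.Normc.normcM normcX in h.
apply: (le_trans (ler_wpM2l r0 h)).
have wn : normc w ^+ n <= r ^+ n by rewrite lerXn2r// nnegrE normc_ge0.
have h1 := ler_wpM2l (normc_ge0 (z - w)) wn.
have h2 := ler_wpM2r (normc_ge0 (z ^+ n - w ^+ n)) zr.
have h3 := ler_wpM2l r0 IHn.
rewrite mulrDr -natr1 exprS.
have h4 := ler_wpM2l r0 h1; have h5 := ler_wpM2l r0 h2.
by apply: (@le_trans _ _ (r * (normc (z - w) * (n%:R * r ^+ n))
    + r * (normc (z - w) * r ^+ n)));
  [apply: lerD => //; exact: le_trans h3|lra].
Qed.

(** The remainder of order [n + 1] is [w] times that of order [n] plus [(z - w) (z^n - w^n)], and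
    [normc_exprB] bounds the latter. The factor [r ^ 2] again avoids lowered exponents. *)
Lemma normc_expr_taylor2 (w z : R[i]) (r : R) n : normc w <= r -> normc z <= r ->
  r ^+ 2 * normc (z ^+ n - w ^+ n - (z - w) * (n%:R * w ^+ n.-1))
    <= normc (z - w) ^+ 2 * (n%:R ^+ 2 * r ^+ n).
Proof.
move=> wr zr; have r0 : 0 <= r := le_trans (normc_ge0 w) wr.
elim: n => [|n IHn].
  by rewrite !expr0 subrr mul0r mulr0 subrr ComplexField.Normc.normc0 mulr0 expr0n mul0r mulr0.
have -> : z ^+ n.+1 - w ^+ n.+1 - (z - w) * (n.+1%:R * w ^+ n)
    = w * (z ^+ n - w ^+ n - (z - w) * (n%:R * w ^+ n.-1)) + (z - w) * (z ^+ n - w ^+ n).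
  case: n {IHn} => [|n]; first by rewrite !expr0 !expr1; ring.
  by rewrite -[n.+2%:R]natr1 !exprS /=; ring.
set a := (X in w * X); rewrite -/a in IHn.
have h := le_normcD (w * a) ((z - w) * (z ^+ n - w ^+ n)).
rewrite !ComplexField.Normc.normcM in h.
apply: (le_trans (ler_wpM2l (sqr_ge0 r) h)).
have h1 := ler_wpM2l (mulr_ge0 r0 (normc_ge0 (z - w))) (normc_exprB n wr zr).
have h2 := ler_wpM2l r0 IHn.
have h3 := ler_wpM2l (sqr_ge0 r) (ler_wpM2r (normc_ge0 a) wr).
(* The induction yields the coefficient [n^2 + n]; this term is the slack up to [(n + 1)^2]. *)
have h4 : 0 <= normc (z - w) ^+ 2 * ((n%:R + 1) * r ^+ n.+1).
  by rewrite mulr_ge0 ?sqr_ge0// mulr_ge0 ?exprn_ge0// addr_ge0.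
rewrite mulrDr -natr1; rewrite (exprS r) in h4 *.
apply: (@le_trans _ _ (r * (normc (z - w) ^+ 2 * (n%:R ^+ 2 * r ^+ n))
   + r * normc (z - w) * (normc (z - w) * (n%:R * r ^+ n)))).
  apply: lerD; first by apply: le_trans h3 _; rewrite expr2 -!mulrA; lra.
  by apply: le_trans h1; rewrite expr2; lra.
by lra.
Qed.

(** With [r] midway between [|w|] and 1, every [h + w] with [|h| < r - |w|] lies in the disc of
    radius [r]. There the componentwise Taylor bounds share one geometric majorant, hence a
    quadratic bound in norm. *)
Lemma is_diff_powseq w : normc w < 1 ->
  is_diff w powseq (fun h : R[i]^o => h *: dpowseq w).
Proof.
move=> w1; pose r := (normc w + 1) / 2.
have w0 := normc_ge0 w.
have [r0 r1 wr] : [/\ 0 < r, r < 1 & normc w < r] by rewrite /r; split; lra.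
have [C [s [C0 s0 s1 hC]]] := sqr_nat_expr_bound (ltW r0) r1.
have [M M0 hM] := l2norm_le_geometric (ltW s0) s1.
have CM : 0 < r ^- 2 * C * M by rewrite !mulr_gt0// invr_gt0 exprn_gt0.
apply: (@is_diff_quadratic _ _ _ _ _ _ (r ^- 2 * C * M)%:C (r - normc w)%:C).
- by move=> a u v; rewrite scalerDl scalerA.
- by move=> h; exact: scalel_continuous.
- by rewrite ltcR.
- by rewrite ltcR subr_gt0.
move=> h hr.
have hr' : normc h < r - normc w by rewrite -ltcR.
have hwr : normc (h + w) < r.
  by apply: le_lt_trans (le_normcD _ _) _; rewrite -ltrBrDr.
suff : l2norm (powseq (h + w) - powseq w - h *: dpowseq w)
    <= (r ^- 2 * C * normc h ^+ 2) * M.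
  rewrite -lecR => /le_trans; apply.
  rewrite (_ : `|h| = (normc h)%:C)// -rmorphXn -rmorphM lecR.
  by rewrite le_eqVlt; apply/orP; left; apply/eqP; ring.
apply: hM; first by rewrite mulr_ge0 ?sqr_ge0// mulr_ge0 ?(ltW C0)// invr_ge0 sqr_ge0.
move=> n.
have -> : (powseq (h + w) - powseq w - h *: dpowseq w) n
  = powseq (h + w) n - powseq w n - (h : R[i]) * dpowseq w n by [].
move: (powseqE n (lt_trans hwr r1)) (powseqE n w1) (dpowseqE n w1).
move: (powseq (h + w)) (powseq w) (dpowseq w) => X Y Z -> -> ->.
have := normc_expr_taylor2 n (ltW wr) (ltW hwr); rewrite addrK.
rewrite -ler_pdivlMl ?exprn_gt0// => /le_trans; apply.
have -> : r ^- 2 * C * normc h ^+ 2 * s ^+ n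
  = r ^- 2 * (normc h ^+ 2 * (C * s ^+ n)) by ring.
apply: ler_wpM2l; first by rewrite invr_ge0 sqr_ge0.
apply: ler_wpM2l; first exact: sqr_ge0.
(* The Taylor bound has [r ^ n] where [hC] has [r ^ n.-1]; [r < 1] closes the gap, also at
   [n = 0]. *)
apply: le_trans (hC n); apply: ler_wpM2l; first exact: sqr_ge0.
by apply: ler_wiXn2l; rewrite ?leq_pred// ltW.
Qed.

Section GramMatrix.
Variable w : R[i]^o.
Hypothesis w1 : normc w < 1.
Let r : R := normc w ^+ 2.

Let r0 : 0 <= r. Proof. exact: sqr_ge0. Qed.
Let r1 : r < 1. Proof. by rewrite expr_lt1// normc_ge0. Qed.
Let wwJ n : (w : R[i]) ^+ n * ((w : R[i]) ^+ n)^*%R = (r ^+ n)%:C.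
Proof. by rewrite -normCK normrX -exprM mulnC exprM rmorphXn rmorphXn. Qed.

Let rE : r%:C = (w : R[i]) * (w : R[i])^*%R.
Proof. by rewrite rmorphXn -normCK. Qed.

Lemma dot_powseq :
  ell2_dot (powseq w) (powseq w) = (1 - (w : R[i]) * (w : R[i])^*%R)^-1.
Proof.
rewrite -rE -(rmorph1 (real_complex R)) -rmorphB -fmorphV -[RHS]mul1r.
apply: ell2_dot_sum (cvg_series_expr r0 r1) => n.
by rewrite powseqE// mul1r wwJ.
Qed.

(** Each term is the conjugate of [w] times the real number [n |w|^(2n-2)]; the term of index 0
    vanishes. *)
Lemma dot_dpowseq_powseq :
  ell2_dot (dpowseq w) (powseq w)
    = (w : R[i])^*%R / (1 - (w : R[i]) * (w : R[i])^*%R) ^+ 2.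
Proof.
rewrite -rE -(rmorph1 (real_complex R)) -rmorphB -rmorphXn -fmorphV.
apply: ell2_dot_sum (cvg_series_nat_expr r0 r1) => -[|n].
  by rewrite dpowseqE// !mul0r rmorph0 mulr0.
rewrite dpowseqE// powseqE// succnK.
have -> : (n.+1%:R * r ^+ n)%:C = n.+1%:R * ((w : R[i]) ^+ n * ((w : R[i]) ^+ n)^*%R).
  by rewrite wwJ rmorphM rmorph_nat.
have -> : ((w : R[i]) ^+ n.+1)^*%R = (w : R[i])^*%R * ((w : R[i]) ^+ n)^*%R.
  by rewrite exprS rmorphM.
by move: ((w : R[i]) ^+ n) (((w : R[i]) ^+ n)^*%R) => x y; ring.
Qed.

Lemma dot_dpowseq :
  ell2_dot (dpowseq w) (dpowseq w)
    = (1 + (w : R[i]) * (w : R[i])^*%R) / (1 - (w : R[i]) * (w : R[i])^*%R) ^+ 3.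
Proof.
rewrite -rE -(rmorph1 (real_complex R)) -rmorphB -rmorphD -rmorphXn -fmorphV.
rewrite -rmorphM -[RHS]mul1r.
apply: ell2_dot_sum (cvg_series_sqr_nat_expr r0 r1) => -[|n].
  by rewrite dpowseqE// !mul0r expr0n mul0r rmorph0 mulr0.
rewrite dpowseqE// succnK mul1r.
have -> : (n.+1%:R ^+ 2 * r ^+ n)%:C
    = n.+1%:R ^+ 2 * ((w : R[i]) ^+ n * ((w : R[i]) ^+ n)^*%R).
  by rewrite wwJ rmorphM rmorphXn rmorph_nat.
have -> : (n.+1%:R * (w : R[i]) ^+ n)^*%R = n.+1%:R * ((w : R[i]) ^+ n)^*%R.
  by rewrite rmorphM rmorph_nat.
by move: ((w : R[i]) ^+ n) (((w : R[i]) ^+ n)^*%R) => x y; ring.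
Qed.

End GramMatrix.

End PowerSequence.

(** * The immersion *)

Section DifferentialScale.
Variables (K : numFieldType) (W : normedModType K).

(** Scaling named as a function of both arguments so that it can be declared bilinear and
    [diff_bilin] yields the product rule. *)
Definition scale_pair (k : K^o) (u : W) : W := (k : K) *: u.

Lemma scale_pair_is_bilinear : bilinear_for
  (GRing.Scale.Law.clone _ _ *:%R _) (GRing.Scale.Law.clone _ _ *:%R _) scale_pair.
Proof.
split=> [u'|u] a x y /=; rewrite /scale_pair.
- by rewrite scalerDl scalerA.
- by rewrite scalerDr !scalerA mulrC.
Qed.

HB.instance Definition _ :=
  bilinear_isBilinear.Build K K^o W W _ _ scale_pair scale_pair_is_bilinear.

Lemma is_diff_scale (V : normedModType K) (k dk : V -> K^o) (g dg : V -> W) (x : V) :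
  is_diff x k dk -> is_diff x g dg ->
  is_diff x (fun y => (k y : K) *: g y)
    (fun h => (k x : K) *: dg h + (dk h : K) *: g x).
Proof.
move=> kx gx.
have cont : continuous (fun q : K^o * W => scale_pair q.1 q.2).
  by move=> q; apply: cvgZ; [exact: cvg_fst|exact: cvg_snd].
have H : is_diff (k x, g x) (fun q : K^o * W => scale_pair q.1 q.2)
    (fun q => scale_pair (k x) q.2 + scale_pair q.1 (g x)).
  by apply: DiffDef; [exact: differentiable_bilin|rewrite diff_bilin].
exact: (@is_diff_comp _ _ _ _ (fun y => (k y, g y)) _ _ _ _ (is_diff_pair kx gx) H).
Qed.

End DifferentialScale.

(** * Coordinates, differential and Gram identity of the immersion *)

Section Immersion.
Variable R : realType.
Implicit Types p q u v : C2 R.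

(* The [a] and [b] of the header. *)
Definition coordA p : R[i]^o := (p.1 : R[i]) + 'i * (p.2 : R[i]).
Definition coordB p : R[i]^o := (p.1 : R[i]) - 'i * (p.2 : R[i]).

Lemma is_diff_coordA p : is_diff p coordA coordA.
Proof.
have lin : linear coordA by move=> k u v; rewrite /coordA /= /GRing.scale /=; ring.
apply: (@is_diff_quadratic _ _ _ _ _ _ 1 1) => //.
- move=> q; apply: cvgD; first exact: cvg_fst.
  by apply: cvgM; [exact: cvg_cst|exact: cvg_snd].
- move=> h _; rewrite [X in `|X|](_ : _ = 0) ?normr0 ?mul1r ?exprn_ge0//.
  by rewrite /coordA /=; ring.
Qed.

Lemma is_diff_coordB p : is_diff p coordB coordB.
Proof.
have lin : linear coordB by move=> k u v; rewrite /coordB /= /GRing.scale /=; ring.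
apply: (@is_diff_quadratic _ _ _ _ _ _ 1 1) => //.
- move=> q; apply: cvgB; first exact: cvg_fst.
  by apply: cvgM; [exact: cvg_cst|exact: cvg_snd].
- move=> h _; rewrite [X in `|X|](_ : _ = 0) ?normr0 ?mul1r ?exprn_ge0//.
  by rewrite /coordB /=; ring.
Qed.

(** The polarized diagonalization: the Levi form involves [herm] at pairs of distinct vectors, so
    the diagonal identity does not suffice. *)
Lemma herm_coord p q : herm p q
  = ((coordA p : R[i]) * (coordA q : R[i])^*%R
     - (coordB p : R[i]) * (coordB q : R[i])^*%R) / 4.
Proof.
rewrite /herm /coordA /coordB !(rmorphD, rmorphN, rmorphM) /= conjCi.
by field.
Qed.

Lemma normc_coord p : domD R p -> normc (coordB p : R[i]) < normc (coordA p : R[i]).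
Proof.
rewrite /domD /= => p0.
rewrite -ltcR -[_%:C]/(`|coordB p : R[i]|) -[ltRHS]/(`|coordA p : R[i]|).
rewrite -ltr_sqr ?nnegrE// !normCK -subr_gt0 -[ltRHS](@divfK _ 4) ?pnatr_eq0//.
by rewrite -herm_coord herm_diag mulr_gt0// ltcR.
Qed.

Lemma coordA_neq0 p : domD R p -> (coordA p : R[i]) != 0.
Proof.
move=> /normc_coord h; apply: contraTneq h => ->.
by rewrite ComplexField.Normc.normc0 -leNgt normc_ge0.
Qed.

Definition immersion p : ell2 R :=
  (2 / (coordA p : R[i])) *: powseq ((coordB p : R[i]) / (coordA p : R[i])).

(** Product and chain rule for [immersion]: the two fractions with [h] are the differentials at [p]
    of [b / a] and of [2 / a]. *)
Definition dimmersion p h : ell2 R :=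
  (2 / (coordA p : R[i])) *: ((((coordB h : R[i]) * (coordA p : R[i])
    - (coordB p : R[i]) * (coordA h : R[i])) / (coordA p : R[i]) ^+ 2)
    *: dpowseq ((coordB p : R[i]) / (coordA p : R[i])))
  + (- 2 * (coordA h : R[i]) / (coordA p : R[i]) ^+ 2)
    *: powseq ((coordB p : R[i]) / (coordA p : R[i])).

Lemma normc_ratio p : domD R p -> normc ((coordB p : R[i]) / (coordA p : R[i])) < 1.
Proof.
move=> Dp; rewrite ComplexField.Normc.normcM ComplexField.Normc.normcV.
have := normc_coord Dp; have := normc_ge0 (coordB p : R[i]) => b0 ba.
by rewrite ltr_pdivrMr ?mul1r// (le_lt_trans b0).
Qed.

Lemma is_diff_immersion p : domD R p -> is_diff p immersion (dimmersion p).
Proof.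
move=> Dp; have a0 := coordA_neq0 Dp.
have dA := is_diff_coordA p; have dB := is_diff_coordB p.
have dV : is_diff p (fun q => (coordA q)^-1 : R[i]^o)
    (fun h => - (coordA p : R[i]) ^- 2 * (coordA h : R[i]) : R[i]^o).
  have dA' : differentiable coordA p by case: dA.
  apply: DiffDef; first exact: differentiableV.
  by rewrite diffV//; case: dA => _ ->.
have dk : is_diff p (fun q => 2 / (coordA q : R[i]) : R[i]^o)
    (fun h => - 2 * (coordA h : R[i]) / (coordA p : R[i]) ^+ 2 : R[i]^o).
  apply: is_diff_eq (is_diffZ 2 dV) _; apply/funext => h.
  by rewrite !fctE /GRing.scale /=; field.
have dw : is_diff p (fun q => (coordB q : R[i]) / (coordA q : R[i]) : R[i]^o)
    (fun h => ((coordB h : R[i]) * (coordA p : R[i])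
    - (coordB p : R[i]) * (coordA h : R[i])) / (coordA p : R[i]) ^+ 2 : R[i]^o).
  apply: is_diff_eq (is_diffM dB dV) _; apply/funext => h.
  by rewrite !fctE /GRing.scale /=; field.
exact: (is_diff_scale dk (is_diff_comp dw (is_diff_powseq (normc_ratio Dp)))).
Qed.

(** What [d'd''] of [|f|^2 = Phi] would give, obtained instead from the Gram matrix. The full
    Hermitian forms agree, and their imaginary parts give the pullback identity. *)
Lemma dot_dimmersion p u v : domD R p ->
  ell2_dot (dimmersion p u) (dimmersion p v) = reval (levi u v) p.
Proof.
move=> Dp; have a0 := coordA_neq0 Dp; have w1 := normc_ratio Dp.
have Pp : (Phi p)%:C = (herm p p)^-1 by rewrite herm_diag /Phi fmorphV.
have p0 : herm p p != 0 by rewrite herm_diag; apply: lt0r_neq0; rewrite ltcR.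
rewrite /levi; cbn [reval]; rewrite Pp.
rewrite /dimmersion !(ell2_dotDl, ell2_dotDr, ell2_dotZl, ell2_dotZr).
(* The fourth Gram entry is the conjugate of the computed mixed one. *)
rewrite -(conj_ell2_dot (dpowseq _) (powseq _)).
rewrite dot_powseq// dot_dpowseq_powseq// dot_dpowseq//.
move: p0 a0; rewrite !herm_coord {w1 Pp Dp}.
move: (coordA p : R[i]) (coordB p : R[i]) (coordA u : R[i]) (coordB u : R[i])
  (coordA v : R[i]) (coordB v : R[i]) => A B a b a' b' p0 A0.
rewrite !(rmorphM, rmorphXn, rmorphB, rmorphD, rmorph1, rmorphN, fmorphV, rmorph_nat) /=.
rewrite !conjCK.
have A'0 : A^*%R != 0 by rewrite conjC_eq0.
(* Conjugates become independent variables, leaving an identity of rational functions. Its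
   denominators involve [A], [A'] and [A * A' - B * B'], the last being [4 * herm p p]. *)
move: p0 A'0; move: (A^*%R) (B^*%R) (a'^*%R) (b'^*%R) => A' B' a'' b'' p0 A'0.
have {}p0 : A * A' - B * B' != 0 by apply: contra_neq p0 => ->; rewrite mul0r.
by field; rewrite p0 A'0 A0.
Qed.

Lemma kahler_immersion_immersion :
  kahler_immersion (domD R) (omega_tilde R) immersion.
Proof.
split=> [p Dp|p Dp u v]; have [df dE] := is_diff_immersion Dp; first exact: df.
by rewrite dE omega0E dot_dimmersion// omega_tilde_Im.
Qed.

End Immersion.

Theorem proposition4p4 (R : realType) :
  kahler_domain (domD R) (omega_tilde R) /\
  exists f : C2 R -> ell2 R, kahler_immersion (domD R) (omega_tilde R) f.
Proof.
split; first exact: kahler_domain_omega_tilde.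
by exists (@immersion R); exact: kahler_immersion_immersion.
Qed.
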